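(* Consider the scalar equation $$x'(t)=-d(t,x(t))+\sum_{j=1}^{k}p_j(t)\,f(x(t-\tau_j))-H(t,x(t)),\qquad t\ge0,$$ with the standing assumptions given in the context. Assume that there is $\delta\in(0,1)$ such that $$G^0(t)<(1-\delta)\sum_{j=1}^{k}p_j(t)\qquad\text{for all } t\ge0,$$ and that there is $c>0$ such that $$\sum_{j=1}^{k}p_j(t)\ge c\qquad\text{for all } t\ge0.$$ Then the solutions of the equation are uniformly persistent.
   Context: $k\ge 1$ is an integer, $\tau_1,\dots,\tau_k>0$ are delays, $\tau^*=\max_j\tau_j$, and $f(y):=ye^{-y}$. The functions $d,H:[0,+\infty)\times[0,+\infty)\to[0,+\infty)$ and $p_j:[0,+\infty)\to[0,+\infty)$ are continuous and nonnegative. Set $G(t,x):=d(t,x)+H(t,x)$; it is assumed that $G(t,x)/x$ is bounded from above (over $t\ge 0$, $x>0$). Define $$G^0(t):=\limsup_{x\to0^+}\frac{d(t,x)+H(t,x)}{x},$$ and assume this limit is uniform in $t$, i.e. for every $\eta>0$ there is $s>0$ such that $G(t,x)/x\le G^0(t)+\eta$ for all $t\ge0$ and $0<x<s$. A solution is a continuous function $x:[-\tau^*,+\infty)\to[0,+\infty)$ whose restriction to $[-\tau^*,0]$ is a given continuous initial function $\varphi:[-\tau^*,0]\to[0,+\infty)$ and which satisfies the equation for $t\ge0$. It is non-trivial if it is not identically zero on $[0,+\infty)$. The solutions are uniformly persistent if there exists $\varepsilon>0$ such that $\liminf_{t\to+\infty}x(t)>\varepsilon$ for every non-trivial solution $x$.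 *)

(* Defs.v *)
From HB Require Import structures.
From mathcomp Require Import all_boot all_order all_algebra.
From mathcomp Require Import all_classical all_reals all_analysis.

Set Implicit Arguments.
Unset Strict Implicit.
Unset Printing Implicit Defensive.

Import Order.TTheory GRing.Theory Num.Theory.
Import numFieldNormedType.Exports.

Local Open Scope classical_set_scope.
Local Open Scope ring_scope.

(* Functions whose mathematical domain is a subset of R or of R * R are
   represented by total functions; every condition below only involves
   their values on that domain. *)

Definition nicholson_f (R : realType) (y : R) : R := y * expR (- y).

(* The default value 0 of the iterated maximum is harmless: delays are positive
   and there is at least one of them. *)
Definition tau_max (R : realType) (k : nat) (tau : 'I_k -> R) : R :=
  \big[Num.max/0]_(j < k) tau j.

Definition Gtot (R : realType) (d H : R -> R -> R) (t x : R) : R :=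
  d t x + H t x.

(* Extended-real valued, as upper limits are in the library. *)
Definition G0 (R : realType) (d H : R -> R -> R) (t : R) : \bar R :=
  limf_esup (fun x : R => (Gtot d H t x / x)%:E) (0 : R)^'+.

Definition rhs (R : realType) (k : nat) (tau : 'I_k -> R) (d H : R -> R -> R)
    (p : 'I_k -> R -> R) (x : R -> R) (t : R) : R :=
  - d t (x t) + \sum_(j < k) p j t * nicholson_f (x (t - tau j)) - H t (x t).

Definition is_initial (R : realType) (k : nat) (tau : 'I_k -> R)
    (phi : R -> R) : Prop :=
  {within `[- tau_max tau, 0], continuous phi} /\
  (forall t : R, - tau_max tau <= t <= 0 -> 0 <= phi t).

(* The derivative in the equation is two-sided for t > 0; at t = 0 it is the
   right derivative, since to the left of 0 the solution is the prescribed
   initial function, which need not be differentiable. *)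
Definition is_solution (R : realType) (k : nat) (tau : 'I_k -> R)
    (d H : R -> R -> R) (p : 'I_k -> R -> R) (phi x : R -> R) : Prop :=
  [/\ {within `[- tau_max tau, +oo[, continuous x},
      (forall t : R, - tau_max tau <= t -> 0 <= x t),
      (forall t : R, - tau_max tau <= t <= 0 -> x t = phi t),
      (forall t : R, 0 < t -> is_derive t (1 : R) x (rhs tau d H p x t)) &
      (fun h : R => h^-1 * (x h - x 0)) @ (0 : R)^'+ --> rhs tau d H p x 0].

Definition nontrivial (R : realType) (x : R -> R) : Prop :=
  ~ (forall t : R, 0 <= t -> x t = 0).

Definition uniformly_persistent (R : realType) (k : nat) (tau : 'I_k -> R)
    (d H : R -> R -> R) (p : 'I_k -> R -> R) : Prop :=
  exists2 eps : R, 0 < eps &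
    forall phi x : R -> R,
      is_initial tau phi -> is_solution tau d H p phi x -> nontrivial x ->
      (eps%:E < limf_einf (fun t : R => (x t)%:E) (pinfty_nbhs R))%E.

(* Main.v *)
Require Import Defs.
From HB Require Import structures.
From mathcomp Require Import all_boot all_order all_algebra.
From mathcomp Require Import all_classical all_reals all_analysis.
From mathcomp Require Import ring lra.

Set Implicit Arguments.
Unset Strict Implicit.
Unset Printing Implicit Defensive.

Import Order.TTheory GRing.Theory Num.Theory.
Import numFieldNormedType.Exports.

Local Open Scope classical_set_scope.
Local Open Scope ring_scope.

(* Since G(t,x) <= M x, a solution satisfies x' >= - M x: it stays positive once
   it is positive, and x(t - tau_j) <= e^(M tau_max) x(t), so a small x(t) forces
   all the delayed values to be small too, where f(y) is close to y. If moreover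
   x >= a on [t - tau_max, t] and x(t) <= (1 + delta/4) a with a small, then the
   production term dominates and x'(t) >= (c delta / 8) a > 0. Hence x has no
   small running minimum over a delay window, so it stays away from 0, and an
   eventual lower bound a can be improved to (1 + delta/4) a until it exceeds a
   threshold e which does not depend on the solution. *)

(** The difference quotients with [h < 0] are already nonpositive, and the two-sided derivative is
    their limit from the left. *)
Lemma is_derive_left_min_le0 (R : realType) (x : R -> R) (a t l : R) :
  a < t -> is_derive t 1 x l -> (forall s, a <= s <= t -> x t <= x s) ->
  l <= 0.
Proof.
move=> at_ [dx <-] xmin.
have /cvg_dnbhs_at_left dxl : h^-1 *: (x (h *: 1 + t) - x t) @[h --> 0^'] -->
    'D_1 x t by exact: dx.
apply: (cvgr_to_le dxl); near=> h.
have h0 : h < 0 by near: h; exact: nbhs_left_lt.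
have ah : a - t < h by near: h; apply: nbhs_left_gt; rewrite subr_lt0.
rewrite /GRing.scale/= mulr1 mulr_le0_ge0 ?invr_le0 ?(ltW h0)//.
by rewrite subr_ge0; apply: xmin; lra.
Unshelve. all: by end_near. Qed.

(* Otherwise a minimum point of [x] over an interval ending below [b] would be a
   left minimum with positive derivative. *)
Lemma barrier (R : realType) (x dx : R -> R) (T b : R) :
  {within `[T, +oo[, continuous x} ->
  (forall t, T < t -> is_derive t 1 x (dx t)) -> b <= x T ->
  (forall t, T < t -> x t < b -> (forall s, T <= s <= t -> x t <= x s) ->
     0 < dx t) ->
  forall t, T <= t -> b <= x t.
Proof.
move=> cx dxP bT up t Tt; rewrite leNgt; apply/negP => xtb.
have cxt : {within `[T, t], continuous x}.
  by apply: continuous_subspaceW cx; apply: subset_itvl.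
have [m] := EVT_min Tt cxt; rewrite in_itv/= => /andP[Tm mt] xmin.
have xmb : x m < b by rewrite (le_lt_trans _ xtb)// xmin// in_itv/= Tt lexx.
have {}Tm : T < m.
  by rewrite lt_neqAle Tm andbT; apply: contraTneq xmb => <-; rewrite -leNgt.
have xmin' s : T <= s <= m -> x m <= x s.
  move=> /andP[Ts sm]; apply: xmin.
  by rewrite in_itv/= Ts (le_trans sm).
have := is_derive_left_min_le0 Tm (dxP _ Tm) xmin'.
by rewrite leNgt up.
Qed.

(** The integrating factor makes [x u * expR (M * (u - s))] nondecreasing in [u]. This serves twice:
    for positivity, and for bounding a delayed value by the current one. *)
Lemma exponential_decay_le (R : realType) (x dx : R -> R) (T M : R) :
  {within `[T, +oo[, continuous x} ->
  (forall t, T < t -> is_derive t 1 x (dx t)) ->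
  (forall t, T < t -> - (M * x t) <= dx t) ->
  forall s t, T <= s -> s <= t -> x s <= x t * expR (M * (t - s)).
Proof.
move=> cx dxP dxM s t Ts st.
pose y u := x u * expR (M * (u - s)).
have dy u : T < u ->
    is_derive u 1 y (x u *: (expR (M * (u - s)) * M) + expR (M * (u - s)) *: dx u).
  move=> Tu; have ? := dxP _ Tu.
  apply: is_deriveM.
  have -> : (fun v => expR (M * (v - s))) = expR \o (fun v => M * (v - s)) by [].
  apply: is_derive1_comp.
  apply: is_derive_eq; rewrite /GRing.scale/=; ring.
have cy : {within `[s, t], continuous y}.
  have cxs : {within `[s, t], continuous x}.
    apply: continuous_subspaceW cx => u /=.
    by rewrite !in_itv/= andbT => /andP[su _]; exact: le_trans su.
  have ce : {within `[s, t], continuous (fun u => expR (M * (u - s)))}.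
    apply: continuous_subspaceT => v.
    apply: (@continuous_comp _ _ _ (fun v => M * (v - s)) expR);
      last exact: continuous_expR.
    apply: cvgM; first exact: cvg_cst.
    by apply: cvgB; [exact: cvg_id|exact: cvg_cst].
  by move=> u; apply: cvgM; [exact: cxs|exact: ce].
have dys u : u \in `]s, t[ -> is_derive u 1 y
   (x u *: (expR (M * (u - s)) * M) + expR (M * (u - s)) *: dx u).
  by rewrite in_itv/= => /andP[su _]; apply: dy; exact: le_lt_trans su.
have [->|st'] := eqVneq s t; first by rewrite subrr mulr0 expR0 mulr1.
have st0 : s < t by rewrite lt_neqAle st' st.
have [u] := MVT st0 dys cy; rewrite in_itv/= => /andP[su _].
rewrite /y subrr mulr0 expR0 mulr1 /GRing.scale/= => yE.
have du := dxM _ (le_lt_trans Ts su).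
rewrite -subr_ge0 yE mulr_ge0//; last lra.
have -> : x u * (expR (M * (u - s)) * M) + expR (M * (u - s)) * dx u =
  expR (M * (u - s)) * (M * x u + dx u) by ring.
by rewrite mulr_ge0 ?expR_ge0//; lra.
Qed.

(** This part of the argument does not see the equation: it only uses the growth estimate over a
    delay window. The level [e] is given in advance, hence uniform; only the time [T'] depends on
    [x]. *)
Lemma delay_growth_persistent (R : realType) (x dx : R -> R)
    (T tau e q gamma : R) :
  {within `[T, +oo[, continuous x} ->
  (forall t, T < t -> is_derive t 1 x (dx t)) ->
  (forall t, T <= t -> 0 < x t) ->
  0 <= tau -> 0 < e -> 1 < q -> 0 < gamma ->
  (forall t a, T + tau < t -> 0 < a <= e ->
     (forall s, t - tau <= s <= t -> a <= x s) -> x t <= q * a ->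
     gamma * a <= dx t) ->
  exists T', forall t, T' <= t -> e <= x t.
Proof.
move=> cx dxP x0 tau0 e0 q1 g0 up.
have cxS S S' : T <= S -> {within `[S, S'], continuous x}.
  move=> TS; apply: continuous_subspaceW cx => u /=.
  by rewrite !in_itv/= andbT => /andP[Su _]; exact: le_trans Su.
have cxSy S : T <= S -> {within `[S, +oo[, continuous x}.
  move=> TS; apply: continuous_subspaceW cx => u /=.
  by rewrite !in_itv/= !andbT => Su; exact: le_trans Su.
(* [a] is the minimum of [x] over the first delay window, capped by [e]. *)
have [a [a0 ae aP]] : exists a, [/\ 0 < a, a <= e & forall t, T <= t -> a <= x t].
  have TTt : T <= T + tau by rewrite lerDl.
  have [m] := EVT_min TTt (cxS T (T + tau) (lexx _)).
  rewrite in_itv/= => /andP[Tm mT] xmin.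
  exists (Num.min e (x m)); split; first by rewrite lt_min e0 x0.
    by rewrite ge_min lexx.
  have ini s : T <= s <= T + tau -> Num.min e (x m) <= x s.
    by move=> sP; rewrite ge_min xmin ?orbT.
  move=> t Tt; have [tT|/ltW Tt'] := leP t (T + tau); first by rewrite ini// Tt.
  apply: (barrier (cxSy _ TTt) _ _ _ Tt') => [s Ts|| s Ts xs smin].
  - by apply: dxP; exact: le_lt_trans Ts.
  - by rewrite ini// TTt lexx.
  have Ts' : T < s by exact: le_lt_trans Ts.
  have xs0 := x0 _ (ltW Ts').
  (* [up] is used at the level [x s] itself. The delay window may reach back before [T + tau], where
     the values are at least [Num.min e (x m)], which exceeds [x s]. *)
  apply: (@lt_le_trans _ _ (gamma * x s)); first exact: mulr_gt0.
  apply: up => //; last by rewrite ler_peMl// ltW.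
    by rewrite xs0 ltW// (lt_le_trans xs)// ge_min lexx.
  move=> u /andP[su us]; have [uT|/ltW Tu] := leP u (T + tau).
    by rewrite (le_trans (ltW xs))// ini// uT andbT; lra.
  by apply: smin; rewrite Tu us.
have step b T1 : 0 < b <= e -> T <= T1 -> (forall t, T1 <= t -> b <= x t) ->
    exists T2, T <= T2 /\ forall t, T2 <= t -> q * b <= x t.
  move=> /andP[b0 be] TT1 bx.
  have TS : T <= T1 + tau by lra.
  have upb t : T1 + tau < t -> x t <= q * b -> gamma * b <= dx t.
    move=> Tt xt; apply: up => //; [lra|by rewrite b0 be|].
    by move=> s /andP[s1 s2]; apply: bx; lra.
  (* If [x] stayed below [q * b], its slope would be at least [gamma * b]; over a time [q / gamma]
     it would gain [q * b], starting from a positive value. *)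
  have [T2 TT2 xT2] : exists2 T2, T1 + tau <= T2 & q * b <= x T2.
    apply: contrapT => no.
    have small t : T1 + tau <= t -> x t < q * b.
      by move=> Tt; rewrite ltNge; apply/negP => xt; apply: no; exists t.
    pose S := T1 + tau; pose S' := S + q / gamma.
    have qg : 0 < q / gamma by rewrite divr_gt0//; lra.
    have SS' : S < S' by rewrite ltrDl.
    have dS u : u \in `]S, S'[ -> is_derive u 1 x (dx u).
      by rewrite in_itv/= => /andP[Su _]; apply: dxP; exact: le_lt_trans Su.
    have [u] := MVT SS' dS (cxS _ _ TS).
    rewrite in_itv/= => /andP[Su _].
    have -> : S' - S = q / gamma by rewrite /S' addrC addKr.
    have du := upb _ Su (ltW (small _ (ltW Su))).
    have bqg : q * b = (gamma * b) * (q / gamma) by field; rewrite gt_eqF.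
    have : q * b <= dx u * (q / gamma) by rewrite bqg ler_pM2r.
    have := small _ (ltW SS'); have := x0 _ TS; rewrite -/S.
    lra.
  have TT2' : T <= T2 by lra.
  exists T2; split => //; apply: (barrier (cxSy _ TT2') _ xT2).
    by move=> t Tt; apply: dxP; exact: le_lt_trans Tt.
  move=> t Tt xt _; apply: (@lt_le_trans _ _ (gamma * b)); first exact: mulr_gt0.
  by apply: upb; [exact: le_lt_trans Tt|exact: ltW].
(* [step] only applies to levels up to [e]; once [q ^+ n * a] exceeds [e], the left alternative
   holds. *)
have iter n : (exists T', forall t, T' <= t -> e <= x t) \/
    exists T', T <= T' /\ forall t, T' <= t -> q ^+ n * a <= x t.
  elim: n => [|n [|[T1 [TT1 IH]]]]; [right|by left|].
    by exists T; split => // t /aP; rewrite expr0 mul1r.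
  have [qe|/ltW qe] := leP (q ^+ n * a) e.
    right; rewrite exprS -mulrA; apply: step TT1 IH.
    by rewrite qe mulr_gt0// exprn_gt0//; lra.
  by left; exists T1 => t /IH; exact: le_trans.
have [n qn] : exists n, e <= q ^+ n * a.
  have qV : `|q^-1| < 1.
    by rewrite ger0_norm ?invr_ge0 ?invf_lt1//; lra.
  have ae0 : 0 < a / e by rewrite divr_gt0.
  have /cvgr0Pnorm_le/(_ _ ae0)[n _ /(_ n (leqnn n))/= qn] := cvg_expr qV.
  exists n.
  have qn0 : 0 < q ^+ n by rewrite exprn_gt0//; lra.
  move: qn; rewrite exprVn ger0_norm; last by rewrite invr_ge0 ltW.
  by rewrite -[q ^- n]div1r ler_pdivrMr// mulrAC ler_pdivlMr// mul1r mulrC.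
have [//|[T' [_ xT']]] := iter n.
by exists T' => t /xT'; exact: le_trans.
Qed.

(** Follows from [expR (- y) >= 1 - y >= 1 - b]. *)
Lemma nicholson_f_ge (R : realType) (a b y : R) :
  0 <= a -> b <= 1 -> a <= y <= b -> a * (1 - b) <= nicholson_f y.
Proof.
move=> a0 b1 /andP[ay yb]; rewrite /nicholson_f.
have := expR_ge1Dx (- y) => ey.
by apply: ler_pM => //; lra.
Qed.

(** Only [x = 0] needs an argument: there the bound passes to the limit by continuity in [x]. This
    case matters because a solution may vanish at some times. *)
Lemma Gtot_le_linear (R : realType) (d H : R -> R -> R) (M : R) :
  {within `[0, +oo[ `*` `[0, +oo[, continuous (fun z : R * R => d z.1 z.2)} ->
  {within `[0, +oo[ `*` `[0, +oo[, continuous (fun z : R * R => H z.1 z.2)} ->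
  (forall t x : R, 0 <= t -> 0 < x -> Gtot d H t x / x <= M) ->
  forall t x, 0 <= t -> 0 <= x -> Gtot d H t x <= M * x.
Proof.
move=> dc Hc GM t x t0; rewrite le_eqVlt => /predU1P[<-|x0]; last first.
  by rewrite -ler_pdivrMr// GM.
have sec (g : R -> R -> R) :
    {within `[0, +oo[ `*` `[0, +oo[, continuous (fun z : R * R => g z.1 z.2)} ->
    g t y @[y --> 0^'+] --> g t 0.
  move=> /subspace_continuousP/(_ (t, 0)) gc.
  have {}gc : g z.1 z.2 @[z --> within (`[0, +oo[ `*` `[0, +oo[)
      (nbhs ((t, 0) : R * R))] --> g t 0.
    by apply: gc; split; rewrite /= in_itv/= ?t0 ?lexx.
  have pr : (t, y) @[y --> 0^'+] -->
      within (`[0, +oo[ `*` `[0, +oo[) (nbhs ((t, 0) : R * R)).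
    have pr0 : (t, y) @[y --> 0^'+] --> ((t, 0) : R * R).
      by apply: (@cvg_pair _ _ _ _ (nbhs t) (nbhs (0 : R)) _ _ _ (fun=> t) id);
        [exact: cvg_cst|apply: cvg_at_right_filter; exact: cvg_id].
    move=> U UA.
    have UP : \forall y \near 0^'+, (`[0, +oo[ `*` `[0, +oo[) (t, y) -> U (t, y).
      exact: pr0 UA.
    suff : \forall y \near 0^'+, U (t, y) by [].
    near=> y; apply: (near UP y) => //.
    by split; rewrite /= in_itv/= ?t0// andbT ltW.
  exact: (cvg_comp _ _ pr gc).
have Gc : Gtot d H t y @[y --> 0^'+] --> Gtot d H t 0.
  by apply: cvgD; exact: sec.
have Mc : M * y @[y --> 0^'+] --> M * 0.
  by apply: cvgMr; apply: cvg_at_right_filter; exact: cvg_id.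
apply: (ler_cvg_to Gc Mc); near=> y.
by rewrite -ler_pdivrMr ?GM.
Unshelve. all: by end_near. Qed.

Theorem theorem1 (R : realType) (k : nat) (tau : 'I_k -> R)
    (d H : R -> R -> R) (p : 'I_k -> R -> R)
    (hk : (1 <= k)%N)
    (htau : forall j : 'I_k, 0 < tau j)
    (d_cont : {within `[0, +oo[ `*` `[0, +oo[,
                 continuous (fun z : R * R => d z.1 z.2)})
    (H_cont : {within `[0, +oo[ `*` `[0, +oo[,
                 continuous (fun z : R * R => H z.1 z.2)})
    (p_cont : forall j : 'I_k, {within `[0, +oo[, continuous (p j)})
    (d_ge0 : forall t x : R, 0 <= t -> 0 <= x -> 0 <= d t x)
    (H_ge0 : forall t x : R, 0 <= t -> 0 <= x -> 0 <= H t x)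
    (p_ge0 : forall (j : 'I_k) (t : R), 0 <= t -> 0 <= p j t)
    (G_bounded : exists M : R, forall t x : R, 0 <= t -> 0 < x ->
       Gtot d H t x / x <= M)
    (G0_uniform : forall eta : R, 0 < eta -> exists2 s : R, 0 < s &
       forall t x : R, 0 <= t -> 0 < x < s ->
         ((Gtot d H t x / x)%:E <= G0 d H t + eta%:E)%E)
    (hG0 : exists2 delta : R, 0 < delta < 1 &
       forall t : R, 0 <= t ->
         (G0 d H t < ((1 - delta) * \sum_(j < k) p j t)%:E)%E)
    (hp : exists2 c : R, 0 < c &
       forall t : R, 0 <= t -> c <= \sum_(j < k) p j t) :
  uniformly_persistent tau d H p.

Proof.

(* Bounds on the loss term and choice of constants *)
have [M GM] := G_bounded; have [delta /andP[dl0 dl1] G0P] := hG0.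
have [c c0 cP] := hp.
have Glin := Gtot_le_linear d_cont H_cont GM.
have G_ge0 t x : 0 <= t -> 0 <= x -> 0 <= Gtot d H t x.
  by move=> t0 x0; rewrite addr_ge0 ?d_ge0 ?H_ge0.
have M0 : 0 <= M.
  by apply: le_trans (GM 0 1 _ _) => //; rewrite divr1 G_ge0.
(* This tolerance is at most [delta / 2] times the sum of the [p j t], so it costs half of the
   margin [delta]. *)
have [s s0 Gs] := G0_uniform (c * delta / 2) ltac:(by rewrite divr_gt0 ?mulr_gt0).
have Gsmall t x : 0 <= t -> 0 < x < s ->
    Gtot d H t x <= (1 - delta / 2) * (\sum_(j < k) p j t) * x.
  move=> t0 /andP[x0 xs]; rewrite -ler_pdivrMr//.
  have cdP : c * delta <= delta * \sum_(j < k) p j t.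
    by rewrite mulrC ler_pM2l ?cP.
  have : ((Gtot d H t x / x)%:E <
      ((1 - delta) * \sum_(j < k) p j t + c * delta / 2)%:E)%E.
    apply: le_lt_trans (Gs _ _ t0 _) _; first by rewrite x0 xs.
    by rewrite EFinD lteD2rE// G0P.
  by rewrite lte_fin => /ltW /le_trans; apply; lra.
have tau_le j : tau j <= tau_max tau by exact: le_bigmax.
have tau0 : 0 <= tau_max tau by exact: bigmax_ge_id.
pose E := expR (M * tau_max tau); have E0 : 0 < E by exact: expR_gt0.
(* When [x t <= (1 + delta / 4) * a] with [a <= e], we get [x t <= 2 * e]. The first bound then
   gives [x t < s], and the second keeps the delayed values, at most [x t * E], below
   [delta / 8]. *)
pose e := Num.min (s / 4) (delta / (16 * E)).
have e0 : 0 < e by rewrite lt_min !divr_gt0// mulr_gt0.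
have es : e <= s / 4 by rewrite ge_min lexx.
have eE : e * E <= delta / 16.
  have -> : delta / 16 = delta / (16 * E) * E by field; rewrite gt_eqF.
  by rewrite ler_pM2r// ge_min lexx orbT.
(* Halving turns the eventual bound [e <= x t] into the strict inequality for the lower limit. *)
exists (e / 2); first by rewrite divr_gt0.

(* Decay estimate and eventual positivity of a solution *)
move=> phi x _ [cx x_ge0 _ dx _] nontriv.
have cxS S : 0 <= S -> {within `[S, +oo[, continuous x}.
  move=> S0; apply: continuous_subspaceW cx => u /=.
  by rewrite !in_itv/= !andbT => ?; lra.
have x0 t : 0 <= t -> 0 <= x t by move=> t0; apply: x_ge0; lra.
have decay := exponential_decay_le (cxS _ (lexx _)) dx.
have {}decay : forall s t, 0 <= s -> s <= t -> x s <= x t * expR (M * (t - s)).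
  apply: decay => t t0.
  have := Glin t (x t) (ltW t0) (x0 _ (ltW t0)).
  have : 0 <= \sum_(j < k) p j t * nicholson_f (x (t - tau j)).
    apply: sumr_ge0 => j _; rewrite mulr_ge0 ?p_ge0 ?(ltW t0)// mulr_ge0 ?expR_ge0//.
    by apply: x_ge0; have := tau_le j; lra.
  rewrite /rhs /Gtot; lra.
have [t0 t00 xt0] : exists2 t0, 0 <= t0 & 0 < x t0.
  apply: contrapT => no; apply: nontriv => t t0; apply/eqP.
  rewrite eq_le x0// andbT leNgt; apply/negP => xt; apply: no; by exists t.
have xpos t : t0 <= t -> 0 < x t.
  move=> tt; have := lt_le_trans xt0 (decay _ _ t00 tt).
  by rewrite pmulr_lgt0// expR_gt0.

(* Growth over a delay window at small values *)
have growth t a : t0 + tau_max tau < t -> 0 < a <= e ->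
     (forall s, t - tau_max tau <= s <= t -> a <= x s) ->
     x t <= (1 + delta / 4) * a -> c * delta / 8 * a <= rhs tau d H p x t.
  move=> tt /andP[a0 ae] ax xta.
  have tge0 : 0 <= t by lra.
  have xt0' : 0 < x t by apply: xpos; lra.
  have da : delta * a <= a by rewrite ler_piMl ?ltW.
  set P := \sum_(j < k) p j t.
  have cP' : c <= P := cP _ tge0.
  have P0 : 0 < P by lra.
  have G1 : Gtot d H t (x t) <= (1 - delta / 2) * P * ((1 + delta / 4) * a).
    apply: le_trans (Gsmall t (x t) tge0 _) _; first by lra.
    by rewrite ler_wpM2l// mulr_ge0 ?ltW//; lra.
  have F1 : P * (a * (1 - delta / 8)) <=
      \sum_(j < k) p j t * nicholson_f (x (t - tau j)).
    rewrite /P mulr_suml; apply: ler_sum => j _.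
    rewrite ler_wpM2l ?p_ge0//.
    have tj := tau_le j; have tj0 := htau j.
    apply: nicholson_f_ge; [exact: ltW|lra|].
    apply/andP; split; first by apply: ax; lra.
    have := decay (t - tau j) t ltac:(lra) ltac:(lra).
    have -> : t - (t - tau j) = tau j by ring.
    move=> /le_trans; apply.
    have : expR (M * tau j) <= E by rewrite ler_expR ler_wpM2l.
    move=> /(ler_wpM2l (ltW xt0')) /le_trans; apply.
    have /le_trans : x t * E <= (2 * e) * E by rewrite ler_pM2r//; lra.
    by apply; lra.
  (* Production minus loss is at least [P * a] times [(1 - delta / 8) - (1 - delta / 2) * (1 + delta
     / 4)], which equals [delta / 8 + delta ^+ 2 / 8]. *)
  have Pa : c * (delta * a) <= P * (delta * a) by rewrite ler_pM2r// mulr_gt0.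
  have Paa : 0 <= P * (delta ^+ 2 * a).
    by rewrite mulr_ge0 ?mulr_ge0 ?exprn_ge0 ?ltW.
  move: G1 F1; rewrite /rhs /Gtot; nra.
have [T' xT'] : exists T', forall t, T' <= t -> e <= x t.
  apply: (delay_growth_persistent (cxS _ t00) _ xpos tau0 e0 _ _ growth).
  - by move=> t tt; apply: dx; lra.
  - lra.
  - by rewrite divr_gt0// mulr_gt0.
rewrite limf_einfE; apply: (@lt_le_trans _ _ e%:E).
  by rewrite lte_fin; lra.
apply: ereal_sup_ge => /=; exists (ereal_inf ((fun t => (x t)%:E) @` [set t | T' <= t])).
  by exists [set t | T' <= t]; first exact/nbhs_pinfty_ge/num_real.
by apply: le_ereal_inf_tmp => _ [t tT' <-]; rewrite lee_fin; exact: xT'.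
Qed.
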